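(* Let $\pi_1$ and $\mu_1$ be probability densities on $\mathbb{R}^d$ with $\pi_1(x)>0$ for all $x$, and assume $D_{\mathrm{KL}}(\mu_1\|\pi_1)<\infty$. Let $\lambda_0,\lambda_1>0$. For probability densities $P$ on $\mathbb{R}^d$ define $$\mathcal{L}_J[P]=\lambda_0\, D_{\mathrm{KL}}(P\|\pi_1)+\lambda_1\, D_{\mathrm{KL}}(\mu_1\|P)\in[0,\infty].$$ Then: (1) $\mathcal{L}_J$ is strictly convex on the convex set of probability densities $P$ with $\mathcal{L}_J[P]<\infty$, and $\mathcal{L}_J$ admits a unique global minimizer $P_*$ among all probability densities on $\mathbb{R}^d$; (2) the minimizer satisfies $D_{\mathrm{KL}}(P_*\|\pi_1)\leqslant D_{\mathrm{KL}}(\mu_1\|\pi_1)$.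
   Context: For probability densities $P,Q$ on $\mathbb{R}^d$, $D_{\mathrm{KL}}(P\|Q)=\int P(x)\log\frac{P(x)}{Q(x)}\,dx$ (with the usual conventions, equal to $+\infty$ if $P$ is not absolutely continuous with respect to $Q$). In the paper, $P$ plays the role of the pushforward density $F_\#\pi_0$ of an exact base distribution under a normalizing flow $F$, and $\mu_1$ is an imperfect approximation of the target $\pi_1$; $\mathcal{L}_J$ is (up to a $P$-independent constant) the weighted Jeffreys divergence training objective. *)

(* Defs.v *)
From HB Require Import structures.
From mathcomp Require Import all_boot all_order all_algebra.
From mathcomp Require Import all_classical all_reals all_analysis.
Set Implicit Arguments. Unset Strict Implicit. Unset Printing Implicit Defensive.
Import Order.TTheory GRing.Theory Num.Theory.
Import numFieldNormedType.Exports.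
Local Open Scope classical_set_scope.
Local Open Scope ring_scope.

(* R^d is modelled as [d.-tuple R], with the library's product (Borel)
   sigma-algebra generated by the coordinate projections. *)

Definition box (R : realType) (d : nat) (a b : d.-tuple R) : set (d.-tuple R) :=
  [set x | forall i : 'I_d, tnth a i <= tnth x i <= tnth b i].

(* mu is the d-dimensional Lebesgue measure: the (unique) measure on the
   Borel sets of R^d giving each box its volume. *)
Definition is_lebesgue_measure (R : realType) (d : nat)
    (mu : {measure set (d.-tuple R) -> \bar R}) : Prop :=
  forall a b : d.-tuple R, (forall i : 'I_d, tnth a i <= tnth b i) ->
    mu (box a b) = (\prod_(i < d) (tnth b i - tnth a i))%:E.

Definition is_density (R : realType) (d : nat)
    (mu : {measure set (d.-tuple R) -> \bar R}) (P : d.-tuple R -> R) : Prop :=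
  [/\ measurable_fun [set: d.-tuple R] P,
      (forall x, 0 <= P x) &
      (\int[mu]_x (P x)%:E = 1)%E].

Definition kl_integrand (R : realType) (p q : R) : \bar R :=
  if p == 0 then 0%E
  else if q == 0 then +oo%E
  else (p * ln (p / q))%:E.

Definition KL (R : realType) (d : nat)
    (mu : {measure set (d.-tuple R) -> \bar R}) (P Q : d.-tuple R -> R) : \bar R :=
  (\int[mu]_x kl_integrand (P x) (Q x))%E.

Definition LJ (R : realType) (d : nat)
    (mu : {measure set (d.-tuple R) -> \bar R}) (lam0 lam1 : R)
    (pi1 mu1 P : d.-tuple R -> R) : \bar R :=
  (lam0%:E * KL mu P pi1 + lam1%:E * KL mu mu1 P)%E.

(* Main.v *)
Require Import Defs.
From HB Require Import structures.
From mathcomp Require Import all_boot all_order all_algebra.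
From mathcomp Require Import all_classical all_reals all_analysis.
From mathcomp Require Import measurable_realfun.
From mathcomp Require Import ring lra.
Import Order.TTheory GRing.Theory Num.Theory.
Import numFieldNormedType.Exports.
Local Open Scope classical_set_scope.
Local Open Scope ring_scope.

(* Adding [q - p] to the integrand of KL makes it nonnegative without changing
   its integral between densities, so that all integrals are monotone and
   additive. Strict convexity follows from the compensation identity
     KL(M|pi) + t KL(P|M) + (1-t) KL(Q|M) = t KL(P|pi) + (1-t) KL(Q|pi)
   for M = t P + (1-t) Q. The minimizer is explicit: the stationarity condition
     lam0 ln(p/pi) - lam1 mu/p = - lam0 ln c
   is solved by p = pi W(lam1/lam0 c mu/pi) / c, where W inverts w ln w on
   [1, +oo[. As W is 1-Lipschitz, bounded below by 1 and sublinear, the mass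
   J(c) of c p is Lipschitz with J(1) >= 1 and J(c) <= c for large c, and the
   intermediate value theorem gives c >= 1 for which p has mass 1. A pointwise
   tangent inequality then makes p minimal. Finally (2) compares LJ at the
   minimizer with LJ(mu1) = lam0 KL(mu1|pi). *)

(** * Pointwise inequalities for the relative entropy integrand *)

Lemma ln_lt_subr1 {R : realType} (x : R) : 0 < x -> x != 1 -> ln x < x - 1.
Proof.
move=> x0 x1; rewrite ltrBrDl -[ltRHS]lnK ?posrE//.
by rewrite expR_gt1Dx// ln_eq0.
Qed.

(** The Bregman divergence of [x ln x], with the logarithm of the quotient split so that [ring] and
    [lra] see [ln p] and [ln q] as atoms. *)
Definition rel_ent {R : realType} (p q : R) : R := p * (ln p - ln q) - p + q.

(** For [p > 0] this is [ln x < x - 1] at [x = q / p], multiplied by [p]. *)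
Lemma rel_ent_gt0 {R : realType} (p q : R) :
  0 <= p -> 0 < q -> p != q -> 0 < rel_ent p q.
Proof.
rewrite /rel_ent le_eqVlt => /predU1P[<-|p0] q0 pq; first by lra.
have qp1 : q / p != 1.
  by apply: contra_neq pq => /(congr1 ( *%R^~ p)); rewrite divfK ?gt_eqF// mul1r.
have := ln_lt_subr1 (q / p) (divr_gt0 q0 p0) qp1.
rewrite ln_div ?posrE// -(ltr_pM2l p0) mulrBr mulrBr mulr1 mulrCA divff ?gt_eqF//.
lra.
Qed.

Lemma rel_entxx {R : realType} (p : R) : rel_ent p p = 0.
Proof. by rewrite /rel_ent; ring. Qed.

Lemma rel_ent_ge0 {R : realType} (p q : R) : 0 <= p -> 0 < q -> 0 <= rel_ent p q.
Proof.
move=> p0 q0; have [<-|pq] := eqVneq p q; first by rewrite rel_entxx.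
exact/ltW/rel_ent_gt0.
Qed.

Definition kl_excess {R : realType} (p q : R) : \bar R :=
  (kl_integrand p q + (q - p)%:E)%E.

Lemma kl_excess0 {R : realType} (p : R) : 0 < p -> kl_excess p 0 = +oo%E.
Proof. by move=> p0; rewrite /kl_excess /kl_integrand gt_eqF// eqxx. Qed.

Lemma kl_excessE {R : realType} (p q : R) : 0 <= p -> 0 <= q ->
  (q = 0 -> p = 0) -> kl_excess p q = (rel_ent p q)%:E.
Proof.
rewrite /kl_excess /kl_integrand => p0 q0 pq; case: ifPn => [/eqP->|pn0].
  by rewrite add0e /rel_ent; congr EFin; ring.
have qn0 : q != 0 by apply: contra_neq pn0.
rewrite (negbTE qn0) ln_div ?posrE ?lt0r ?pn0 ?qn0//.
by rewrite -EFinD /rel_ent; congr EFin; ring.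
Qed.

Lemma kl_excess_gt0 {R : realType} (p q : R) :
  0 <= p -> 0 <= q -> p != q -> (0 < kl_excess p q)%E.
Proof.
move=> p0; rewrite le_eqVlt => /predU1P[<-|q0] pq.
  by rewrite kl_excess0// lt0r pq.
rewrite kl_excessE//; last by lra.
  by rewrite lte_fin rel_ent_gt0.
exact: ltW.
Qed.

Lemma kl_excessxx {R : realType} (p : R) : 0 <= p -> kl_excess p p = 0%E.
Proof. by move=> p0; rewrite kl_excessE// rel_entxx. Qed.

Lemma kl_excess_ge0 {R : realType} (p q : R) :
  0 <= p -> 0 <= q -> (0 <= kl_excess p q)%E.
Proof.
move=> p0 q0; have [<-|pq] := eqVneq p q; first by rewrite kl_excessxx.
exact/ltW/kl_excess_gt0.
Qed.

(** Both weights are positive, so [m = 0] forces [p = q = 0]. Hence no infinite value occurs, and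
    what remains is a ring identity in the logarithms. *)
Lemma kl_excess_compensation {R : realType} (p q s t : R) :
  0 <= p -> 0 <= q -> 0 < s -> 0 < t < 1 -> let m := t * p + (1 - t) * q in
  (kl_excess m s + (t%:E * kl_excess p m + (1 - t)%:E * kl_excess q m) =
   t%:E * kl_excess p s + (1 - t)%:E * kl_excess q s)%E.
Proof.
move=> p0 q0 s0 /andP[t0 t1] m.
have tp0 : 0 <= t * p by rewrite mulr_ge0// ltW.
have tq0 : 0 <= (1 - t) * q by rewrite mulr_ge0// subr_ge0 ltW.
have m0 : 0 <= m by rewrite /m addr_ge0.
have mp : m = 0 -> p = 0.
  move=> mE; have : t * p = 0 by rewrite /m in mE; lra.
  by move=> /eqP; rewrite mulf_eq0 gt_eqF//= => /eqP.
have mq : m = 0 -> q = 0.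
  move=> mE; have : (1 - t) * q = 0 by rewrite /m in mE; lra.
  by move=> /eqP; rewrite mulf_eq0 gt_eqF ?subr_gt0//= => /eqP.
have sn0 x : s = 0 -> x = 0 :> R by lra.
rewrite !kl_excessE// ?(ltW s0)//; try exact: sn0.
rewrite -!EFinM -!EFinD; congr EFin.
by rewrite /rel_ent /m; ring.
Qed.

(** In the average of [rel_ent m p >= 0] and [rel_ent m q >= 0] with weights [t] and [1 - t] the
    linear parts cancel, leaving [m] times the concavity gap. *)
Lemma ln_concave {R : realType} (p q t : R) :
  0 < p -> 0 < q -> 0 < t < 1 ->
  t * ln p + (1 - t) * ln q <= ln (t * p + (1 - t) * q).
Proof.
move=> p0 q0 /andP[t0 t1]; set m := t * p + (1 - t) * q.
have m0 : 0 < m by rewrite addr_gt0// mulr_gt0// subr_gt0.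
have := rel_ent_ge0 m p (ltW m0) p0; have := rel_ent_ge0 m q (ltW m0) q0.
rewrite /rel_ent => hq hp.
have hp' : 0 <= t * (m * (ln m - ln p) - m + p) by rewrite mulr_ge0// ltW.
have hq' : 0 <= (1 - t) * (m * (ln m - ln q) - m + q).
  by rewrite mulr_ge0// subr_ge0 ltW.
rewrite -subr_ge0 -(pmulr_rge0 _ m0).
have -> : m * (ln m - (t * ln p + (1 - t) * ln q)) =
  t * (m * (ln m - ln p) - m + p) + (1 - t) * (m * (ln m - ln q) - m + q).
  by rewrite /m; ring.
exact: addr_ge0.
Qed.

(** For [u = 0] both sides are the same linear expression. For [u > 0] a vanishing [p] or [q] makes
    the right side [+oo], and otherwise concavity of [ln] decides. *)
Lemma kl_excess_convexr {R : realType} (u p q t : R) :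
  0 <= u -> 0 <= p -> 0 <= q -> 0 < t < 1 ->
  (kl_excess u (t * p + (1 - t) * q)%R <=
   t%:E * kl_excess u p + (1 - t)%:E * kl_excess u q)%E.
Proof.
move=> u0 p0 q0 t01; have /andP[t0 t1] := t01.
have t1' : 0 < 1 - t by rewrite subr_gt0.
have m0 : 0 <= t * p + (1 - t) * q by rewrite addr_ge0// mulr_ge0// ltW.
move: u0; rewrite le_eqVlt => /predU1P[<-|u0].
  rewrite !kl_excessE// -!EFinM -!EFinD lee_fin /rel_ent.
  by rewrite le_eqVlt; apply/orP; left; apply/eqP; ring.
move: p0; rewrite le_eqVlt => /predU1P[<-|p0].
  rewrite (kl_excess0 u)// gt0_muley ?lte_fin// addye ?leey//.
  by rewrite gt_eqF// (lt_le_trans (ltNyr 0))// mule_ge0 ?kl_excess_ge0// ?lee_fin ltW.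
move: q0; rewrite le_eqVlt => /predU1P[<-|q0].
  rewrite (kl_excess0 u)// gt0_muley ?lte_fin// addey ?leey//.
  by rewrite gt_eqF// (lt_le_trans (ltNyr 0))// mule_ge0 ?kl_excess_ge0// ?lee_fin ltW.
have m0' : 0 < t * p + (1 - t) * q by rewrite addr_gt0// mulr_gt0.
have eq0u x : 0 < x -> x = 0 -> u = 0 by move=> /gt_eqF/eqP.
rewrite !kl_excessE ?(ltW u0) ?(ltW p0) ?(ltW q0)//; try exact: eq0u.
rewrite -!EFinM -!EFinD lee_fin /rel_ent -subr_ge0.
set M := t * p + _.
have -> : t * (u * (ln u - ln p) - u + p) + (1 - t) * (u * (ln u - ln q) - u + q) -
  (u * (ln u - ln M) - u + M) = u * (ln M - (t * ln p + (1 - t) * ln q)).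
  by rewrite /M; ring.
by rewrite mulr_ge0 ?(ltW u0)// subr_ge0 ln_concave.
Qed.

(* [p] is the critical point of the Lagrangian of [LJ] under the constraint of
   unit mass, with multiplier [lam0 * L] up to a constant; the terms are moved
   across so that both sides are nonnegative. *)
Lemma kl_excess_lagrangian {R : realType} (lam0 lam1 L p q s u : R) :
  0 < lam0 -> 0 < lam1 -> 0 <= L -> 0 < p -> 0 <= q -> 0 < s -> 0 <= u ->
  lam0 * (ln p - ln s) = lam1 * (u / p) - lam0 * L ->
  (lam0%:E * kl_excess p s + lam1%:E * kl_excess u p
     + (lam0 * L * p + lam1 * q)%:E <=
   lam0%:E * kl_excess q s + lam1%:E * kl_excess u q
     + (lam0 * L * q + lam1 * p)%:E)%E.
Proof.
move=> l0 l1 L0 p0 q0 s0 u0 crit.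
(* If [q = 0] and [u > 0] the right side is [+oo]; in the other case every term is real. *)
have [[uN0 qE0]|uq] : (u != 0 /\ q = 0) \/ (q = 0 -> u = 0).
  have [->|] := eqVneq u 0; first by right.
  by have [->|qn0] := eqVneq q 0; [left|right => qE; rewrite qE eqxx in qn0].
  rewrite qE0 (kl_excess0 u) ?lt0r ?uN0// gt0_muley ?lte_fin//.
  rewrite addey ?addye ?leey//.
  by rewrite gt_eqF// (lt_le_trans (ltNyr 0))// mule_ge0 ?kl_excess_ge0// ?lee_fin ltW.
have eq0 x y : 0 < x -> x = 0 -> y = 0 :> R by move=> /gt_eqF/eqP.
rewrite !kl_excessE ?(ltW p0) ?(ltW s0)//; try exact: eq0.
rewrite -!EFinM -!EFinD lee_fin -subr_ge0.
have h1 := rel_ent_ge0 q p q0 p0.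
have h2 : 0 <= (u / p) * (q - p) + u * (ln p - ln q).
  have [->|un0] := eqVneq u 0; first by rewrite !mul0r addr0.
  have q0' : 0 < q by rewrite lt0r q0 andbT; apply: contra_neq un0.
  have := rel_ent_ge0 p q (ltW p0) q0'.
  have -> : u / p * (q - p) + u * (ln p - ln q) = u / p * rel_ent p q.
    by rewrite /rel_ent; field; rewrite gt_eqF.
  by move=> ?; rewrite mulr_ge0// divr_ge0// ltW.
set v := u / p in crit h2.
set lhs := (X in 0 <= X).
(* The gap splits into the Bregman remainders at [p] of the two convex terms and a first-order term
   in [q - p], whose coefficient vanishes by [crit]. *)
have -> : lhs = lam0 * rel_ent q p + lam1 * (v * (q - p) + u * (ln p - ln q)) +
  (lam0 * (ln p - ln s) - (lam1 * v - lam0 * L)) * (q - p).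
  by rewrite /lhs /rel_ent; ring.
rewrite crit subrr mul0r addr0 addr_ge0// mulr_ge0// ltW//.
Qed.

(** * The inverse of [w ln w] on [[1, +oo[] *)

(** Truncating the argument at 0 makes [W] monotone on the whole line, from which its measurability
    is obtained. *)
Lemma exists_xlnx_inv {R : realType} :
  exists W : R -> R, forall y, 1 <= W y /\ W y * ln (W y) = Num.max 0 y.
Proof.
suff h (y : R) : exists w : R, 1 <= w /\ w * ln w = Num.max 0 y.
  exists (fun y => projT1 (cid (h y))) => y.
  exact: (projT2 (cid (h y))).
set z := Num.max 0 y; have z0 : 0 <= z by rewrite /z le_max lexx.
(* The endpoint [1 + z] is large enough because [w ln w >= w - 1]. *)
have [|||w] := @IVT R (fun x => x * ln x) 1 (1 + z) z.
- by rewrite lerDl.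
- apply: continuous_in_subspaceT => x; rewrite inE/= in_itv/= => /andP[x1 _].
  by apply: continuousM; [exact: cvg_id|apply: continuous_ln; lra].
- rewrite ln1 mulr0 ge_min z0/= le_max; apply/orP; right.
  have := rel_ent_ge0 (1 + z) 1; rewrite /rel_ent ln1 subr0; lra.
rewrite in_itv/= => /andP[w1 _] wz; by exists w.
Qed.

(** The slope [1 + ln w] of [w ln w] is at least 1 on [[1, +oo[]; the inequality
    [rel_ent (W y) (W z) >= 0] is the tangent bound at [W z]. *)
Lemma xlnx_inv_lip {R : realType} (W : R -> R) (y z : R) :
  (forall y, 1 <= W y /\ W y * ln (W y) = Num.max 0 y) ->
  W y <= W z + `|y - z|.
Proof.
move=> HW; have [y1 yE] := HW y; have [z1 zE] := HW z.
have [//|yz] := leP (W y) (W z).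
  by move=> h; rewrite (le_trans h)// lerDl.
have := rel_ent_ge0 (W y) (W z); rewrite /rel_ent => h.
have lz := ln_ge0 z1.
have : 0 <= (W y - W z) * ln (W z) by rewrite mulr_ge0// subr_ge0 ltW.
have hm : Num.max 0 y - Num.max 0 z <= `|y - z|.
  have [] := leP 0 y; have [] := leP 0 z; have := ler_norm (y - z); have := normr_ge0 (y - z); lra.
lra.
Qed.

Lemma xlnx_inv_homo {R : realType} (W : R -> R) (y z : R) :
  (forall y, 1 <= W y /\ W y * ln (W y) = Num.max 0 y) -> y <= z -> W y <= W z.
Proof.
move=> HW yz; have [y1 yE] := HW y; have [z1 zE] := HW z.
rewrite leNgt; apply/negP => zy.
have : W z * ln (W z) < W y * ln (W y).
  rewrite ltr_pM ?ln_ge0//; first by lra.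
  by rewrite ltr_ln ?posrE//; lra.
by rewrite yE zE ltNge le_max2 ?lexx.
Qed.

(** Either [W y <= K], or [W y * ln K <= W y * ln (W y) = y]. A large [K] makes the slope in [y] as
    small as desired. *)
Lemma xlnx_inv_le {R : realType} (W : R -> R) (K y : R) :
  (forall y, 1 <= W y /\ W y * ln (W y) = Num.max 0 y) -> 1 < K -> 0 <= y ->
  W y <= K + y / ln K.
Proof.
move=> HW K1 y0; have [y1 yE] := HW y.
have lK : 0 < ln K by rewrite ln_gt0.
have yK : 0 <= y / ln K by rewrite divr_ge0// ltW.
have [|KW] := leP (W y) K; first by lra.
suff : W y <= y / ln K by lra.
rewrite ler_pdivlMr// (le_trans (_ : _ <= W y * ln (W y)))//.
  by rewrite ler_pM2l ?ler_ln ?posrE//; lra.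
by rewrite yE max_r.
Qed.

(** * Measurability, and [KL] as the integral of a nonnegative function *)

Lemma measurable_kl_integrand {d} {T : measurableType d} {R : realType}
    (P Q : T -> R) :
  measurable_fun setT P -> measurable_fun setT Q ->
  (forall x, 0 <= P x) -> (forall x, 0 <= Q x) ->
  measurable_fun setT (fun x => kl_integrand (P x) (Q x)).
Proof.
move=> mP mQ P0 Q0.
have -> : (fun x => kl_integrand (P x) (Q x)) =
    (fun x => if P x == cst 0 x then cst 0%E x else
      if Q x == cst 0 x then cst +oo%E x else
      (P x * (ln (P x) - ln (Q x)))%:E).
  apply/funext => x; rewrite /kl_integrand /=; case: ifPn => // Px.
  by case: ifPn => // Qx; rewrite ln_div ?posrE ?lt0r ?Px ?Qx ?P0 ?Q0.
apply: measurable_fun_ifT => //.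
  exact: measurable_fun_eqr.
apply: measurable_fun_ifT => //.
  exact: measurable_fun_eqr.
apply/measurable_EFinP; apply: measurable_funM => //.
apply: measurable_funB; apply: measurableT_comp => //; exact: measurable_ln.
Qed.

Lemma measurable_kl_excess {d} {T : measurableType d} {R : realType}
    (P Q : T -> R) :
  measurable_fun setT P -> measurable_fun setT Q ->
  (forall x, 0 <= P x) -> (forall x, 0 <= Q x) ->
  measurable_fun setT (fun x => kl_excess (P x) (Q x)).
Proof.
move=> mP mQ P0 Q0; apply: emeasurable_funD.
  exact: measurable_kl_integrand.
by apply/measurable_EFinP; exact: measurable_funB.
Qed.

(** The negative part of the integrand is dominated by [Q], so its integral is finite and can be
    subtracted even when the positive part has infinite integral. *)
Lemma KL_excess {R : realType} {d : nat}
    {leb : {measure set (d.-tuple R) -> \bar R}} (P Q : d.-tuple R -> R) :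
  is_density leb P -> is_density leb Q ->
  (KL leb P Q = \int[leb]_x kl_excess (P x) (Q x))%E.
Proof.
move=> [mP P0 intP] [mQ Q0 intQ].
pose f x : \bar R := kl_integrand (P x) (Q x).
have mf : measurable_fun setT f by exact: measurable_kl_integrand.
have mg : measurable_fun setT (fun x => kl_excess (P x) (Q x)).
  exact: measurable_kl_excess.
have mEP : measurable_fun setT (EFin \o P) by exact/measurable_EFinP.
have mEQ : measurable_fun setT (EFin \o Q) by exact/measurable_EFinP.
have g0 x : (0 <= kl_excess (P x) (Q x))%E by exact: kl_excess_ge0.
have fge x : ((- Q x)%:E <= f x)%E.
  have := g0 x; rewrite /kl_excess -/(f x).
  have := P0 x; case: (f x) => [r| |] P0x //=.
  - by rewrite -EFinD !lee_fin; lra.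
  - by move=> _; rewrite leey.
have fnegQ x : (f^\- x <= (Q x)%:E)%E.
  by rewrite funenegE ge_max lee_fin Q0 andbT leeNl -EFinN.
have fneg_le1 : (\int[leb]_x f^\- x <= 1)%E.
  rewrite -intQ; apply: ge0_le_integral => //.
  exact: measurable_funeneg.
have fneg_fin : (\int[leb]_x f^\- x)%E \is a fin_num.
  by rewrite ge0_fin_numE ?integral_ge0// (le_lt_trans fneg_le1)// ltry.
(* The pointwise identity is [f^\+ + Q = kl_excess P Q + (P + f^\-)]: all terms are nonnegative, so
   it integrates without any finiteness condition. *)
have key : (\int[leb]_x f^\+ x + 1 =
    \int[leb]_x kl_excess (P x) (Q x) + (1 + \int[leb]_x f^\- x))%E.
  rewrite -[in LHS]intQ -intP -!ge0_integralD//=; first last.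
  - by move=> x _; rewrite lee_fin.
  - exact: measurable_funepos.
  - exact: measurable_funeneg.
  - by move=> x _; rewrite lee_fin.
  - by apply: emeasurable_funD => //; exact: measurable_funeneg.
  - by move=> x _; rewrite adde_ge0 ?lee_fin.
  apply: eq_integral => x _; rewrite /kl_excess -/(f x) funeposE funenegE.
  have := fge x; case: (f x) => [r _| _|]//=.
  - rewrite -?EFinN -!EFin_max -!EFinD; congr EFin.
    have [] := leP r 0; have [] := leP (- r) 0; lra.
  - by rewrite max_l ?leey// max_r ?leNye//.
rewrite /KL integralE -/f.
move: key fneg_fin.
case: (\int[leb]_x f^\- x)%E => [n||]//; case: (\int[leb]_x f^\+ x)%E => [a||]//=;
  case: (\int[leb]_x kl_excess _ _)%E => [b||]//=.
by rewrite -!EFinD => -[abn] _; congr EFin; lra.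
Qed.

Lemma ge0_integral_lin {d} {T : measurableType d} {R : realType}
    (mu : {measure set T -> \bar R}) (f g : T -> \bar R) (a b : R) :
  measurable_fun setT f -> (forall x, 0 <= f x)%E ->
  measurable_fun setT g -> (forall x, 0 <= g x)%E -> 0 <= a -> 0 <= b ->
  (\int[mu]_x (a%:E * f x + b%:E * g x) =
   a%:E * \int[mu]_x f x + b%:E * \int[mu]_x g x)%E.
Proof.
move=> mf f0 mg g0 a0 b0; rewrite ge0_integralD//.
- by rewrite !ge0_integralZl.
- by move=> x _; rewrite mule_ge0.
- exact: measurable_funeM.
- by move=> x _; rewrite mule_ge0.
- exact: measurable_funeM.
Qed.

(** * Mass normalization of the candidate minimizer *)

(** The bound [1 <= c] serves to make the multiplier [ln c] of the critical equation nonnegative. *)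
Lemma exists_normalization {d} {T : measurableType d} {R : realType}
    (mu : {measure set T -> \bar R}) (f g : T -> R) (a : R) (W : R -> R) :
  measurable_fun setT f -> (forall x, 0 < f x) -> (\int[mu]_x (f x)%:E = 1)%E ->
  measurable_fun setT g -> (forall x, 0 <= g x) -> (\int[mu]_x (g x)%:E = 1)%E ->
  0 < a -> (forall y, 1 <= W y /\ W y * ln (W y) = Num.max 0 y) ->
  exists c, [/\ 1 <= c,
    measurable_fun setT (fun x => c^-1 * (f x * W (a * c * (g x / f x)))) &
    (\int[mu]_x (c^-1 * (f x * W (a * c * (g x / f x))))%:E = 1)%E].
Proof.
move=> mf f0 intf mg g0 intg a0 HW.
pose F c x := f x * W (a * c * (g x / f x)).
(* The mass of [c] times the candidate, so that unit mass means [I c = c]. *)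
pose I c := (\int[mu]_x (F c x)%:E)%E.
have gf0 x : 0 <= g x / f x by rewrite divr_ge0// ltW.
have mF c : measurable_fun setT (F c).
  apply: measurable_funM => //; apply: measurableT_comp.
    by apply: nondecreasing_measurable => // y z; exact: xlnx_inv_homo.
  apply: measurable_funM => //; apply: measurable_funM => //.
  have -> : (fun x => (f x)^-1) = (fun x => expR (- ln (f x))).
    by apply/funext => x; rewrite expRN lnK// posrE.
  apply: measurableT_comp => //; apply: measurable_funN.
  by apply: measurableT_comp => //; exact: measurable_ln.
have fF c x : f x <= F c x.
  by rewrite /F ler_peMr ?(ltW (f0 x))//; have [] := HW (a * c * (g x / f x)).
have F0 c x : 0 <= F c x by rewrite (le_trans _ (fF c x))// ltW.
have mE h : measurable_fun setT h -> measurable_fun setT (EFin \o h : T -> \bar R).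
  by move=> ?; exact/measurable_EFinP.
have lin (h : T -> R) (u v : R) : measurable_fun setT h -> (forall x, 0 <= h x) ->
    0 <= u -> 0 <= v ->
    (\int[mu]_x (u * h x + v * g x)%:E = u%:E * \int[mu]_x (h x)%:E + v%:E)%E.
  move=> mh h0 u0 v0.
  under eq_integral do rewrite EFinD EFinM (EFinM v).
  rewrite (ge0_integral_lin mu (EFin \o h) (EFin \o g))//=; first by rewrite intg mule1.
  - exact: mE.
  - exact: mE.
have I1 c : (1 <= I c)%E.
  rewrite -intf; apply: ge0_le_integral => //.
  - by move=> x _; rewrite lee_fin ltW.
  - exact: mE.
  - exact: mE.
  - by move=> x _; rewrite lee_fin.
(* Pointwise, [F c x] has Lipschitz constant [a * g x] in [c], since the factor [f x] cancels the
   denominator; and [g] has mass 1. *)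
have Ilip c c' : (I c <= I c' + (a * `|c - c'|)%:E)%E.
  have k0 : 0 <= a * `|c - c'| by rewrite mulr_ge0// ltW.
  have := lin (F c') 1 _ (mF c') (F0 c') ler01 k0; rewrite mul1e => <-.
  apply: ge0_le_integral => //.
  - by move=> x _; rewrite lee_fin.
  - exact: mE.
  - apply: mE; apply: measurable_funD; apply: measurable_funM => //.
  move=> x _; rewrite lee_fin mul1r.
  have h := xlnx_inv_lip W (a * c * (g x / f x)) (a * c' * (g x / f x)) HW.
  rewrite -(ler_pM2l (f0 x)) in h; apply: le_trans h _.
  rewrite mulrDr lerD2l -mulrBl -mulrBr 2!normrM (gtr0_norm a0) (ger0_norm (gf0 x)).
  by rewrite le_eqVlt; apply/orP; left; apply/eqP; field; rewrite gt_eqF.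
have IK c K : 1 < K -> 0 <= c -> (I c <= (K + a * c / ln K)%:E)%E.
  move=> K1 c0; have lK : 0 < ln K by rewrite ln_gt0.
  have v0 : 0 <= a * c / ln K by rewrite divr_ge0 ?mulr_ge0// ltW.
  have K0 : 0 <= K by rewrite (le_trans ler01)// ltW.
  have := lin f K _ mf (fun x => ltW (f0 x)) K0 v0.
  rewrite intf mule1 -EFinD => <-.
  apply: ge0_le_integral => //.
  - by move=> x _; rewrite lee_fin.
  - exact: mE.
  - apply: mE; apply: measurable_funD; apply: measurable_funM => //.
  move=> x _; rewrite lee_fin.
  have y0 : 0 <= a * c * (g x / f x) by rewrite mulr_ge0// mulr_ge0// ltW.
  have h := xlnx_inv_le W K _ HW K1 y0.
  rewrite -(ler_pM2l (f0 x)) in h; apply: le_trans h _.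
  rewrite le_eqVlt; apply/orP; left; apply/eqP; field.
  by rewrite !gt_eqF.
have Ifin c : I c \is a fin_num.
  rewrite ge0_fin_numE ?(le_trans _ (I1 c))//.
  (* The Lipschitz bound reduces finiteness for every real [c] to [c = 0], where [IK] applies. *)
  rewrite (le_lt_trans (Ilip c 0))// lte_add_pinfty ?ltry//.
  by rewrite (le_lt_trans (IK 0 2 _ _)) ?ltry// ltr1n.
pose J c := fine (I c).
have IJ c : I c = (J c)%:E by rewrite fineK.
have Jlip c c' : J c <= J c' + a * `|c - c'|.
  by rewrite -lee_fin EFinD -!IJ.
have cJ : continuous J.
  move=> c; apply/cvgrPdist_lt => e e0.
  apply/nbhs_ballP; exists (e / a); first exact: divr_gt0.
  move=> c' /=; rewrite ltr_pdivlMr// mulrC => cc'.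
  rewrite (le_lt_trans _ cc')// ler_norml.
  have := Jlip c c'; have := Jlip c' c; rewrite (distrC c' c); lra.
(* With [ln K = 2 * a] the bound [IK] reads [K + c / 2], which equals [c] at [c = 2 * K]. *)
pose K := expR (2 * a).
have K1 : 1 < K by rewrite expR_gt1 mulr_gt0.
have [|||c] := @IVT R (fun c => J c - c) 1 (2 * K) 0.
- by lra.
- apply: continuous_subspaceT => c; apply: continuousB; first exact: cJ.
  exact: cvg_id.
- have J1 : 1 <= J 1 by rewrite -lee_fin -IJ.
  have JK : J (2 * K) <= 2 * K.
    have B0 : 0 <= 2 * K by lra.
    rewrite -lee_fin -IJ (le_trans (IK _ K K1 B0))// lee_fin.
    rewrite {3}/K expRK le_eqVlt; apply/orP; left; apply/eqP; field.
    by rewrite gt_eqF.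
  by rewrite ge_min le_max; apply/andP; split; apply/orP; [right|left]; lra.
rewrite in_itv/= => /andP[c1 _] /eqP; rewrite subr_eq0 => /eqP Jc.
have c0 : 0 < c by lra.
exists c; split => //; first by apply: measurable_funM => //; exact: mF.
under eq_integral do rewrite EFinM.
rewrite ge0_integralZl//.
- by rewrite -/(I c) IJ Jc -EFinM mulVf// gt_eqF.
- exact/mE/mF.
- by move=> x _; rewrite lee_fin F0.
- by rewrite lee_fin invr_ge0 ltW.
Qed.

(** * Positivity, compensation and convexity of [KL] *)

Lemma KL_ge0 {R : realType} {d : nat}
    {leb : {measure set (d.-tuple R) -> \bar R}} (P Q : d.-tuple R -> R) :
  is_density leb P -> is_density leb Q -> (0 <= KL leb P Q)%E.
Proof.
move=> dP dQ; rewrite KL_excess//; apply: integral_ge0 => x _.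
by have [_ P0 _] := dP; have [_ Q0 _] := dQ; exact: kl_excess_ge0.
Qed.

Lemma KLxx {R : realType} {d : nat}
    {leb : {measure set (d.-tuple R) -> \bar R}} (P : d.-tuple R -> R) :
  is_density leb P -> KL leb P P = 0%E.
Proof.
move=> dP; rewrite KL_excess//; have [_ P0 _] := dP.
by under eq_integral do rewrite kl_excessxx//; rewrite integral0.
Qed.

(** A nonnegative function with zero integral vanishes almost everywhere, and [kl_excess] vanishes
    only on the diagonal. *)
Lemma KL_eq0 {R : realType} {d : nat}
    {leb : {measure set (d.-tuple R) -> \bar R}} (P Q : d.-tuple R -> R) :
  is_density leb P -> is_density leb Q -> KL leb P Q = 0%E ->
  {ae leb, forall x, P x = Q x}.
Proof.
move=> dP dQ; rewrite KL_excess// => PQ0.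
have [mP P0 _] := dP; have [mQ Q0 _] := dQ.
have mk : measurable_fun setT (fun x => kl_excess (P x) (Q x)).
  exact: measurable_kl_excess.
have /(ae_eq_integral_abs leb measurableT mk) :
    (\int[leb]_x `|kl_excess (P x) (Q x)| = 0)%E.
  by under eq_integral do rewrite gee0_abs ?kl_excess_ge0//.
apply: filterS => x /= /(_ I) k0; apply/eqP; apply: contraT => PQ.
by have := kl_excess_gt0 _ _ (P0 x) (Q0 x) PQ; rewrite k0 ltxx.
Qed.

Lemma is_density_conv {R : realType} {d : nat}
    {leb : {measure set (d.-tuple R) -> \bar R}} (P Q : d.-tuple R -> R) (t : R) :
  is_density leb P -> is_density leb Q -> 0 < t < 1 ->
  is_density leb (fun x => t * P x + (1 - t) * Q x).
Proof.
move=> [mP P0 intP] [mQ Q0 intQ] /andP[/ltW t0 t1].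
have t1' : 0 <= 1 - t by rewrite subr_ge0 ltW.
split.
- by apply: measurable_funD; apply: measurable_funM.
- by move=> x; rewrite addr_ge0// mulr_ge0.
- under eq_integral do rewrite EFinD EFinM (EFinM (1 - t)).
  rewrite (ge0_integral_lin leb (EFin \o P) (EFin \o Q))//=.
  + by rewrite intP intQ !mule1 -EFinD addrC subrK.
  + exact/measurable_EFinP.
  + exact/measurable_EFinP.
Qed.

Lemma KL_compensation {R : realType} {d : nat}
    {leb : {measure set (d.-tuple R) -> \bar R}} (P Q S : d.-tuple R -> R) (t : R) :
  is_density leb P -> is_density leb Q -> is_density leb S ->
  (forall x, 0 < S x) -> 0 < t < 1 ->
  let M := fun x => t * P x + (1 - t) * Q x in
  (KL leb M S + (t%:E * KL leb P M + (1 - t)%:E * KL leb Q M) =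
   t%:E * KL leb P S + (1 - t)%:E * KL leb Q S)%E.
Proof.
move=> dP dQ dS Spos t01 M.
have dM : is_density leb M by exact: is_density_conv.
have [mP P0 _] := dP; have [mQ Q0 _] := dQ; have [mS S0 _] := dS.
have [mM M0 _] := dM.
have /andP[t0 t1] := t01.
have k0 (A B : d.-tuple R -> R) x : (forall x, 0 <= A x) -> (forall x, 0 <= B x) ->
  (0 <= kl_excess (A x) (B x))%E by move=> *; exact: kl_excess_ge0.
rewrite !KL_excess// -!ge0_integral_lin ?subr_ge0 ?(ltW t0) ?(ltW t1)//;
  try (by move=> x; exact: k0); try exact: measurable_kl_excess.
rewrite -ge0_integralD//.
- by apply: eq_integral => x _; exact: kl_excess_compensation.
- by move=> x _; exact: k0.
- exact: measurable_kl_excess.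
- by move=> x _; rewrite adde_ge0// mule_ge0 ?k0// lee_fin ?subr_ge0 ltW.
- by apply: emeasurable_funD; apply: measurable_funeM; exact: measurable_kl_excess.
Qed.

Lemma KL_convexr {R : realType} {d : nat}
    {leb : {measure set (d.-tuple R) -> \bar R}} (U P Q : d.-tuple R -> R) (t : R) :
  is_density leb U -> is_density leb P -> is_density leb Q -> 0 < t < 1 ->
  (KL leb U (fun x => (t * P x + (1 - t) * Q x)%R) <=
   t%:E * KL leb U P + (1 - t)%:E * KL leb U Q)%E.
Proof.
move=> dU dP dQ t01.
have dM := is_density_conv _ _ _ dP dQ t01.
have [mP P0 _] := dP; have [mQ Q0 _] := dQ; have [mU U0 _] := dU.
have [mM M0 _] := dM.
have /andP[t0 t1] := t01.
have k0 (A B : d.-tuple R -> R) x : (forall x, 0 <= A x) -> (forall x, 0 <= B x) ->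
  (0 <= kl_excess (A x) (B x))%E by move=> *; exact: kl_excess_ge0.
rewrite !KL_excess// -!ge0_integral_lin ?subr_ge0 ?(ltW t0) ?(ltW t1)//;
  try (by move=> x; exact: k0); try exact: measurable_kl_excess.
apply: ge0_le_integral => //.
- by move=> x _; exact: kl_excess_ge0 (U0 x) (M0 x).
- exact: measurable_kl_excess mU mM U0 M0.
- by apply: emeasurable_funD; apply: measurable_funeM; exact: measurable_kl_excess.
- by move=> x _; exact: kl_excess_convexr.
Qed.

(** * Strict convexity of [LJ] and minimality of critical densities *)

Lemma lincomb_lt_pinfty {R : realType} (a b : R) (x y : \bar R) :
  0 < a -> 0 < b -> (0 <= x)%E -> (0 <= y)%E ->
  (a%:E * x + b%:E * y < +oo)%E ->
  exists r s : R, [/\ x = r%:E & y = s%:E].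
Proof.
move=> a0 b0; case: x => [r| |]//; case: y => [s| |]// _ _.
- by exists r, s.
- by rewrite gt0_muley ?lte_fin.
- by rewrite gt0_muley ?lte_fin.
- by rewrite !gt0_muley ?lte_fin.
Qed.

(** Strictness comes from the first term alone, whose convexity gap is given by the compensation
    identity; the second term only needs to be convex. *)
Lemma LJ_strictly_convex {R : realType} {d : nat}
    {leb : {measure set (d.-tuple R) -> \bar R}} (pi1 mu1 P Q : d.-tuple R -> R)
    (lam0 lam1 t : R) :
  is_density leb pi1 -> (forall x, 0 < pi1 x) -> is_density leb mu1 ->
  0 < lam0 -> 0 < lam1 ->
  is_density leb P -> (LJ leb lam0 lam1 pi1 mu1 P < +oo)%E ->
  is_density leb Q -> (LJ leb lam0 lam1 pi1 mu1 Q < +oo)%E ->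
  0 < t < 1 ->
  let M := fun x => t * P x + (1 - t) * Q x in
  (LJ leb lam0 lam1 pi1 mu1 M < +oo)%E /\
  (~ {ae leb, forall x, P x = Q x} ->
   (LJ leb lam0 lam1 pi1 mu1 M <
    t%:E * LJ leb lam0 lam1 pi1 mu1 P
    + (1 - t)%:E * LJ leb lam0 lam1 pi1 mu1 Q)%E).
Proof.
move=> dpi pi0 dmu l0 l1 dP finP dQ finQ t01 M.
have dM : is_density leb M by exact: is_density_conv.
have /andP[t0 t1] := t01; have t1' : 0 < 1 - t by rewrite subr_gt0.
have := KL_compensation P Q pi1 t dP dQ dpi pi0 t01; rewrite -/M.
have := KL_convexr mu1 P Q t dmu dP dQ t01; rewrite -/M.
have KPM := KL_ge0 _ _ dP dM; have KQM := KL_ge0 _ _ dQ dM.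
have KMp := KL_ge0 _ _ dM dpi; have KmM := KL_ge0 _ _ dmu dM.
have PM0 := KL_eq0 _ _ dP dM; have QM0 := KL_eq0 _ _ dQ dM.
rewrite /LJ.
have [p1 [p2 [-> ->]]] := lincomb_lt_pinfty _ _ _ _ l0 l1
  (KL_ge0 _ _ dP dpi) (KL_ge0 _ _ dmu dP) finP.
have [q1 [q2 [-> ->]]] := lincomb_lt_pinfty _ _ _ _ l0 l1
  (KL_ge0 _ _ dQ dpi) (KL_ge0 _ _ dmu dQ) finQ.
move: KmM KMp; case: (KL leb mu1 M) => [v| |]// _.
case: (KL leb M pi1) => [u| |]// _ vle comp; last first.
  move: comp; rewrite addye// gt_eqF// (lt_le_trans (ltNyr 0))//.
  by rewrite adde_ge0// mule_ge0// lee_fin ltW.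
have [x [y [xE yE]]] : exists x y, [/\ KL leb P M = x%:E & KL leb Q M = y%:E].
  apply: (lincomb_lt_pinfty t (1 - t)) => //.
  move: comp; case: (_ * _ + _ * KL leb Q M)%E => [r| |]//.
  by rewrite ltry.
move: comp vle; rewrite xE yE -!EFinM -!EFinD => -[comp]; rewrite !lee_fin => vle.
split; first by rewrite ltry.
move=> PQ.
(* If both divergences from [M] vanished, [P] and [Q] would equal [M] almost everywhere, hence each
   other. *)
have xy : 0 < t * x + (1 - t) * y.
  move: KPM KQM; rewrite xE yE !lee_fin => x0 y0.
  rewrite lt0r addr_ge0 ?mulr_ge0 ?(ltW t0) ?(ltW t1')// andbT.
  apply/negP; rewrite paddr_eq0 ?mulr_ge0 ?(ltW t0) ?(ltW t1')//.
  rewrite !mulf_eq0 (gt_eqF t0) (gt_eqF t1')/= => /andP[/eqP x00 /eqP y00].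
  apply: PQ; move: (PM0 (etrans xE (congr1 EFin x00))) (QM0 (etrans yE (congr1 EFin y00))).
  by apply: filterS2 => z -> ->.
rewrite lte_fin.
have : lam0 * (u + (t * x + (1 - t) * y)) = lam0 * (t * p1 + (1 - t) * q1) by rewrite comp.
have : lam1 * v <= lam1 * (t * p2 + (1 - t) * q2) by rewrite ler_pM2l.
have : 0 < lam0 * (t * x + (1 - t) * y) by exact: mulr_gt0.
lra.
Qed.

(** [kl_excess_lagrangian] is integrated. As [Ps] and [P] both have mass 1, its linear terms add the
    same finite constant to both sides, which cancels even if [LJ] is infinite at [P]. *)
Lemma LJ_le_of_critical {R : realType} {d : nat}
    {leb : {measure set (d.-tuple R) -> \bar R}} (pi1 mu1 Ps P : d.-tuple R -> R)
    (lam0 lam1 L : R) :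
  is_density leb pi1 -> (forall x, 0 < pi1 x) -> is_density leb mu1 ->
  0 < lam0 -> 0 < lam1 -> 0 <= L ->
  is_density leb Ps -> (forall x, 0 < Ps x) ->
  (forall x, lam0 * (ln (Ps x) - ln (pi1 x)) = lam1 * (mu1 x / Ps x) - lam0 * L) ->
  is_density leb P ->
  (LJ leb lam0 lam1 pi1 mu1 Ps <= LJ leb lam0 lam1 pi1 mu1 P)%E.
Proof.
move=> dpi pi0 dmu l0 l1 L0 dPs Ps0 crit dP.
have LJE Q : is_density leb Q -> LJ leb lam0 lam1 pi1 mu1 Q =
    (\int[leb]_x (lam0%:E * kl_excess (Q x) (pi1 x)
                  + lam1%:E * kl_excess (mu1 x) (Q x)))%E.
  move=> dQ; have [mQ Q0 _] := dQ; have [mp p0 _] := dpi; have [mm m0 _] := dmu.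
  rewrite /LJ !KL_excess// ge0_integral_lin ?(ltW l0) ?(ltW l1)//.
  - exact: measurable_kl_excess.
  - by move=> x; exact: kl_excess_ge0.
  - exact: measurable_kl_excess.
  - by move=> x; exact: kl_excess_ge0.
have c0 : 0 <= lam0 * L by rewrite mulr_ge0// ltW.
have intD Q S : is_density leb Q -> is_density leb S ->
    (LJ leb lam0 lam1 pi1 mu1 Q + (lam0 * L + lam1)%:E =
     \int[leb]_x (lam0%:E * kl_excess (Q x) (pi1 x)
       + lam1%:E * kl_excess (mu1 x) (Q x) + (lam0 * L * Q x + lam1 * S x)%:E))%E.
  move=> dQ dS; have [mQ Q0 intQ] := dQ; have [mS S0 intS] := dS.
  have [mp p0 _] := dpi; have [mm m0 _] := dmu.
  rewrite ge0_integralD//.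
  - rewrite -LJE//; congr (_ + _)%E.
    under eq_integral do rewrite EFinD EFinM (EFinM lam1).
    rewrite (ge0_integral_lin leb (EFin \o Q) (EFin \o S)) ?(ltW l1)//=.
    + by rewrite intQ intS !mule1.
    + exact/measurable_EFinP.
    + exact/measurable_EFinP.
  - by move=> x _; rewrite adde_ge0 ?mule_ge0 ?kl_excess_ge0 ?lee_fin ?(ltW l0) ?(ltW l1).
  - by apply: emeasurable_funD; apply: measurable_funeM; exact: measurable_kl_excess.
  - by move=> x _; rewrite lee_fin addr_ge0// mulr_ge0// ltW.
  - by apply/measurable_EFinP; apply: measurable_funD; apply: measurable_funM.
rewrite -(leeD2rE (x := (lam0 * L + lam1)%:E))//.
rewrite (intD _ _ dPs dP) (intD _ _ dP dPs).
have [mQ Q0 _] := dP; have [mPs _ _] := dPs.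
have [mp p0 _] := dpi; have [mm m0 _] := dmu.
have int0 (A B : d.-tuple R -> R) x : (forall x, 0 <= A x) -> (forall x, 0 <= B x) ->
    (0 <= lam0%:E * kl_excess (A x) (pi1 x) + lam1%:E * kl_excess (mu1 x) (A x)
      + (lam0 * L * A x + lam1 * B x)%:E)%E.
  move=> A0 B0; rewrite adde_ge0 ?adde_ge0 ?mule_ge0 ?kl_excess_ge0 ?lee_fin ?(ltW l0) ?(ltW l1)//.
  by rewrite addr_ge0// mulr_ge0// ltW.
have mint (A B : d.-tuple R -> R) : measurable_fun setT A -> measurable_fun setT B ->
    (forall x, 0 <= A x) -> measurable_fun setT (fun x =>
      lam0%:E * kl_excess (A x) (pi1 x) + lam1%:E * kl_excess (mu1 x) (A x)
      + (lam0 * L * A x + lam1 * B x)%:E)%E.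
  move=> mA mB A0; apply: emeasurable_funD.
    by apply: emeasurable_funD; apply: measurable_funeM; exact: measurable_kl_excess.
  by apply/measurable_EFinP; apply: measurable_funD; apply: measurable_funM.
apply: ge0_le_integral => //.
- by move=> x _; apply: int0 => // y; exact: ltW.
- by apply: mint => // y; exact: ltW.
- exact: mint.
- by move=> x _; exact: kl_excess_lagrangian.
Qed.

(** * Existence and uniqueness of the minimizer, and its divergence bound *)

Theorem theorem1 (R : realType) (d : nat)
  (leb : {measure set (d.-tuple R) -> \bar R})
  (Hleb : is_lebesgue_measure leb)
  (pi1 mu1 : d.-tuple R -> R) (lam0 lam1 : R)
  (Hpi1 : is_density leb pi1) (Hpi1pos : forall x, 0 < pi1 x)
  (Hmu1 : is_density leb mu1)
  (HKL : (KL leb mu1 pi1 < +oo)%E)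
  (Hlam0 : 0 < lam0) (Hlam1 : 0 < lam1) :
  (* (1a) the set {P density | L_J[P] < oo} is convex and L_J is strictly
     convex on it (densities being identified up to a.e. equality) *)
  (forall (P Q : d.-tuple R -> R) (t : R),
      is_density leb P -> (LJ leb lam0 lam1 pi1 mu1 P < +oo)%E ->
      is_density leb Q -> (LJ leb lam0 lam1 pi1 mu1 Q < +oo)%E ->
      0 < t < 1 ->
      let M := fun x => t * P x + (1 - t) * Q x in
      [/\ is_density leb M,
          (LJ leb lam0 lam1 pi1 mu1 M < +oo)%E &
          (~ {ae leb, forall x, P x = Q x} ->
           (LJ leb lam0 lam1 pi1 mu1 M <
            t%:E * LJ leb lam0 lam1 pi1 mu1 P
            + (1 - t)%:E * LJ leb lam0 lam1 pi1 mu1 Q)%E)]) /\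
  (* (1b) unique global minimizer, and (2) *)
  (exists Ps : d.-tuple R -> R,
      [/\ is_density leb Ps,
          (forall P, is_density leb P ->
             (LJ leb lam0 lam1 pi1 mu1 Ps <= LJ leb lam0 lam1 pi1 mu1 P)%E),
          (forall P, is_density leb P ->
             LJ leb lam0 lam1 pi1 mu1 P = LJ leb lam0 lam1 pi1 mu1 Ps ->
             {ae leb, forall x, P x = Ps x}) &
          (KL leb Ps pi1 <= KL leb mu1 pi1)%E]).
Proof.
have convex P Q t dP finP dQ finQ t01 := LJ_strictly_convex pi1 mu1 P Q lam0 lam1 t
  Hpi1 Hpi1pos Hmu1 Hlam0 Hlam1 dP finP dQ finQ t01.
split.
  move=> P Q t dP finP dQ finQ t01 M.
  have [finM strict] := convex P Q t dP finP dQ finQ t01.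
  by split => //; exact: is_density_conv.
have [W HW] := @exists_xlnx_inv R.
have [mpi pi0 intpi] := Hpi1; have [mmu mu0 intmu] := Hmu1.
have a0 : 0 < lam1 / lam0 by exact: divr_gt0.
have [c [c1 mPs intPs]] := exists_normalization leb pi1 mu1 (lam1 / lam0) W
  mpi Hpi1pos intpi mmu mu0 intmu a0 HW.
set Ps := (fun x : d.-tuple R => c^-1 * _) in mPs.
have c0 : 0 < c by rewrite (lt_le_trans ltr01).
have W0 y : 0 < W y by have [W1 _] := HW y; rewrite (lt_le_trans ltr01).
have Ps0 x : 0 < Ps x by rewrite /Ps !mulr_gt0// invr_gt0.
have dPs : is_density leb Ps by split => // x; exact: ltW.
have crit x : lam0 * (ln (Ps x) - ln (pi1 x)) =
    lam1 * (mu1 x / Ps x) - lam0 * ln c.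
  set y := lam1 / lam0 * c * (mu1 x / pi1 x).
  have [_] := HW y; rewrite max_r; last first.
    rewrite /y; apply: mulr_ge0; first by rewrite mulr_ge0// ltW.
    by rewrite divr_ge0.
  have -> : Ps x = c^-1 * (pi1 x * W y) by [].
  rewrite !lnM ?lnV ?posrE ?invr_gt0 ?mulr_gt0//.
  (* Solving [W y * ln (W y) = y] for [mu1 x] leaves a field identity in [pi1 x], [W y] and the
     logarithms. *)
  move=> Wy; have -> : mu1 x = lam0 * pi1 x * (W y * ln (W y)) / (lam1 * c).
    by rewrite Wy /y; field; rewrite !gt_eqF.
  by field; rewrite !gt_eqF.
have minPs P : is_density leb P ->
    (LJ leb lam0 lam1 pi1 mu1 Ps <= LJ leb lam0 lam1 pi1 mu1 P)%E.
  exact: (@LJ_le_of_critical _ _ _ _ _ _ _ _ _ (ln c)) (ln_ge0 c1) _ _ crit.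
have LJmu : LJ leb lam0 lam1 pi1 mu1 mu1 = (lam0%:E * KL leb mu1 pi1)%E.
  by rewrite /LJ KLxx// mule0 adde0.
have finPs : (LJ leb lam0 lam1 pi1 mu1 Ps < +oo)%E.
  rewrite (le_lt_trans (minPs _ Hmu1))// LJmu.
  by rewrite lte_mul_pinfty// ?lee_fin ?ltW.
exists Ps; split => //.
(* If [P] differed from [Ps] on a non-negligible set, strict convexity would put the value at their
   midpoint below the minimum. *)
- move=> P dP PPs; apply: contrapT => neq.
  have finP : (LJ leb lam0 lam1 pi1 mu1 P < +oo)%E by rewrite PPs.
  have h01 : 0 < (2^-1 : R) < 1 by lra.
  have [_ /(_ neq)] := convex P Ps 2^-1 dP finP dPs finPs h01.
  rewrite PPs -ge0_muleDl ?lee_fin; [|lra|lra].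
  rewrite -EFinD (_ : 2^-1 + (1 - 2^-1) = 1 :> R); last by lra.
  rewrite mul1e ltNge minPs//; exact: is_density_conv.
- rewrite -(lee_pmul2l (x := lam0%:E)) ?lte_fin// -LJmu.
  rewrite (le_trans _ (minPs _ Hmu1))// /LJ leeDl// mule_ge0 ?KL_ge0//.
  by rewrite lee_fin ltW.
Qed.
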